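(* Let $Q=\{1,2,\ldots,n\}$ be a naturally ordered $k$-translatable groupoid whose multiplication table has first row $a_1,a_2,\ldots,a_n$. Then $Q$ is a semigroup with the multiplication $i\cdot j=a_j$ (for all $i,j\in Q$) if and only if $a_s=a_{[s+k]_n}=a_{a_s}$ for every $s\in Q$.
   Context: A groupoid is a set with a binary operation $\cdot$; a semigroup is an associative groupoid. For an integer $x$, $[x]_n$ denotes the residue of $x$ modulo $n$, represented in $\{1,\ldots,n\}$, with $0$ identified with $n$. For $1\le k<n$, a groupoid $Q=\{1,\ldots,n\}$ is $k$-translatable (with respect to the natural ordering) if in its multiplication table each row $i$, $2\le i\le n$, is obtained from row $i-1$ by cyclically shifting it $k$ places to the right, i.e. $i\cdot j=(i-1)\cdot[j-k]_n$ for all $j$ and all $2\le i\le n$. The first row is $a_j=1\cdot j$, $j=1,\ldots,n$. *)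

(* Defs.v *)
From mathcomp Require Import all_boot all_order all_algebra.
Set Implicit Arguments.
Unset Strict Implicit.
Unset Printing Implicit Defensive.
Import GRing.Theory Num.Theory.

Definition carrier (n : nat) := {i : nat | 1 <= i <= n}.

(* [x]_n, with representatives 1, ..., n: a remainder of 0 is replaced by n. *)
Definition residue (n : nat) (x : int) : nat :=
  if `|(x %% n)%Z|%N is r.+1 then r.+1 else n.

Lemma residue_range (n : nat) (x : int) : 0 < n -> 1 <= residue n x <= n.
Proof.
move=> n_gt0; rewrite /residue.
have := ltz_pmod x (_ : (0 < n%:Z)%R); rewrite ltz_nat => /(_ n_gt0).
have : (0 <= (x %% n)%Z)%R by apply: modz_ge0; rewrite eqz_nat -lt0n.
case: (x %% n)%Z => // [[|r]] _ /=; first by rewrite n_gt0 leqnn.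
by rewrite ltz_nat => /ltnW.
Qed.

Lemma carrier_gt0 (n : nat) (j : carrier n) : 0 < n.
Proof. by have /andP[j_gt0 j_le] := valP j; apply: leq_trans j_gt0 j_le. Qed.

(* The element [j + x]_n of the carrier. *)
Definition shift (n : nat) (j : carrier n) (x : int) : carrier n :=
  exist _ (residue n ((val j)%:Z + x)%R) (residue_range _ (carrier_gt0 j)).

(* As i ranges over the elements having a predecessor p = i - 1 in the carrier,
   it takes exactly the values 2, ..., n; row 1 is not constrained by row n. *)
Definition translatable (n k : nat)
    (mul : carrier n -> carrier n -> carrier n) : Prop :=
  forall p i j : carrier n, val i = (val p).+1 ->
    mul i j = mul p (shift j (- k%:Z)%R).

Definition first_row (n : nat) (mul : carrier n -> carrier n -> carrier n)
    (a : carrier n -> carrier n) : Prop :=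
  forall i j : carrier n, val i = 1 -> a j = mul i j.

(* Main.v *)
Require Import Defs.
From mathcomp Require Import all_boot all_order all_algebra.
Set Implicit Arguments.
Unset Strict Implicit.
Unset Printing Implicit Defensive.

(** If every row of the table is the first row [a], then comparing rows 1 and 2
    in the translatability condition says exactly that [a] is unchanged when
    its argument is shifted by [k]; and since [i * j = a j], the two
    bracketings of a triple ending in [s] are [a s] and [a (a s)], so
    associativity is the identity [a s = a (a s)].  Conversely, if [a] is
    unchanged by the shift by [k], then each row, being a shift by [k] of the
    row above it, equals that row ([mul_first_row]), so all rows equal [a], and
    [a s = a (a s)] is again associativity.  The only arithmetic needed is that
    the shifts by [x] and by [- x] are mutually inverse ([shiftK]). *)

Lemma residue_mod (n : nat) (x : int) :
  0 < n -> (residue n x = x %[mod n])%Z.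
Proof.
move=> n_gt0; rewrite /residue.
have : (0 <= (x %% n)%Z)%R by apply: modz_ge0; rewrite eqz_nat -lt0n.
rewrite -[RHS]modz_mod; case: (x %% n)%Z => // [[|r]] _ //=.
by rewrite modzz mod0z.
Qed.

Lemma eq_residue (n : nat) (x y : int) :
  (x = y %[mod n])%Z -> residue n x = residue n y.
Proof. by rewrite /residue => ->. Qed.

Lemma residue_val (n : nat) (j : carrier n) : residue n (val j) = val j.
Proof.
case: j => [[|m] //= m_lt]; rewrite /residue modz_nat /=.
have [->|m_neq] := eqVneq m.+1 n; first by rewrite modnn.
by rewrite modn_small // ltn_neqAle m_neq.
Qed.

Lemma shiftK (n : nat) (x : int) (j : carrier n) :
  shift (shift j x) (- x)%R = j.
Proof.
apply: val_inj; rewrite /= -[RHS]residue_val; apply: eq_residue.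
by rewrite -modzDml residue_mod ?(carrier_gt0 j) // modzDml GRing.addrK.
Qed.

Lemma shiftNK (n : nat) (x : int) (j : carrier n) :
  shift (shift j (- x)%R) x = j.
Proof. by rewrite -[X in shift _ X]GRing.opprK shiftK. Qed.

(** Induction on the row: row [i] is row [i - 1], which is [a], shifted by [k],
    and that shift does not change [a]. *)
Lemma mul_first_row (n k : nat) (mul : carrier n -> carrier n -> carrier n)
    (a : carrier n -> carrier n) :
  translatable k mul -> first_row mul a ->
  (forall s, a s = a (shift s k)) -> forall i j, mul i j = a j.
Proof.
move=> htrans hrow a_shift [i i_range].
elim: i i_range => [//|[|i] IHi] i_range j; first by rewrite -hrow.
have p_range : 1 <= i.+1 <= n by case/andP: i_range => _ /ltnW.
rewrite (htrans (exist _ i.+1 p_range)) // IHi.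
by rewrite a_shift shiftNK.
Qed.

Theorem theorem5p22 (n k : nat) (hk : 1 <= k < n)
    (mul : carrier n -> carrier n -> carrier n) (a : carrier n -> carrier n)
    (htrans : translatable k mul) (hrow : first_row mul a) :
  (associative mul /\ (forall i j : carrier n, mul i j = a j)) <->
  (forall s : carrier n,
     a s = a (shift s (Posz k)) /\ a (shift s (Posz k)) = a (a s)).
Proof.
split=> [[mulA mulE] s | a_fix].
  have n_gt1 : 1 < n by case/andP: hk; apply: leq_ltn_trans.
  have a_shift : a s = a (shift s k).
    have row2 : 1 <= 2 <= n by [].
    have row1 : 1 <= 1 <= n by apply: ltnW.
    have := htrans (exist _ 1 row1) (exist _ 2 row2) (shift s k) erefl.
    by rewrite !mulE shiftK.
  by split=> //; rewrite -a_shift; have := mulA s s s; rewrite !mulE.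
have a_shift s : a s = a (shift s k) by case: (a_fix s).
have mulE := mul_first_row htrans hrow a_shift.
split=> // x y z; rewrite !mulE.
by have [_ <-] := a_fix z; rewrite -a_shift.
Qed.
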